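(* For every $\varepsilon>0$ we have $$ m(n)<\frac{n^{\rho}}{\exp\left((\log n)^{1/\rho}/(\log\log n)^{1+\varepsilon+o(1)}\right)} $$ for integers $n>2$, where $o(1)$ denotes a quantity (which may depend on $\varepsilon$) tending to $0$ as $n\to\infty$.
   Context: For a positive integer $n$, $m(n)$ denotes the number of ordered factorizations of $n$ into factors larger than $1$, i.e. the number of finite sequences $(d_1,\dots,d_r)$, $r\ge 1$, of integers $d_i\ge 2$ with $d_1d_2\cdots d_r=n$ (so $m(1)=0$). $\rho=1.72864\dots$ is the unique real number $\rho>1$ with $\zeta(\rho)=2$, where $\zeta(s)=\sum_{n\ge1}n^{-s}$. $\log$ is the natural logarithm. *)

(* Defs.v *)
From mathcomp Require Import all_boot all_order all_algebra.
From mathcomp Require Import finmap.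
From mathcomp Require Import all_classical all_reals all_analysis.

Set Implicit Arguments.
Unset Strict Implicit.
Unset Printing Implicit Defensive.

Import Order.TTheory GRing.Theory Num.Theory.
Import numFieldNormedType.Exports.

Local Open Scope classical_set_scope.

Definition ordered_factorizations (n : nat) : set (seq nat) :=
  [set s | [/\ (1 <= size s)%N,
               (forall d, d \in s -> (2 <= d)%N) &
               (\prod_(d <- s) d)%N = n]].

(* [fset_set] is the empty set on infinite sets; the cardinal below is the
   intended one because the set of factorizations is finite. *)
Lemma finite_ordered_factorizations (n : nat) :
  finite_set (ordered_factorizations n).
Proof.
have bnd s : (forall d, d \in s -> (2 <= d)%N) ->
    (size s < \prod_(d <- s) d)%N /\
    (forall d, d \in s -> (d <= \prod_(e <- s) e)%N).
  elim: s => [|a s IH] H; first by rewrite big_nil.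
  have a2 : (2 <= a)%N by apply: H; rewrite mem_head.
  have [|hs hd] := IH; first by move=> d ds; apply: H; rewrite inE ds orbT.
  have p0 : (0 < \prod_(d <- s) d)%N by apply: leq_ltn_trans hs.
  rewrite big_cons /=; split.
    apply: (@leq_trans (2 * \prod_(d <- s) d)%N); last by rewrite leq_mul2r a2 orbT.
    by rewrite mul2n -addnn -[X in (X <= _)%N]add1n leq_add.
  move=> d; rewrite inE => /orP[/eqP->|/hd le_d]; first by rewrite leq_pmulr.
  by apply: (leq_trans le_d); rewrite leq_pmull // ltnW.
apply: (@sub_finite_set _ _
    (range (fun t : n.-bseq 'I_n.+1 => [seq val i | i <- t]))); last first.
  by apply: finite_image; exact: finite_finset.
move=> s /= [_ s2 sn]; have [] := bnd s s2; rewrite sn => sz le_n.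
have szt : (size [seq @inord n d | d <- s] <= n)%N by rewrite size_map ltnW.
exists (Bseq szt) => //=; rewrite -map_comp map_id_in // => d ds.
by rewrite /= inordK // ltnS le_n.
Qed.

Definition m (n : nat) : nat := #|` fset_set (ordered_factorizations n)|%fset.

Local Open Scope ring_scope.

(* The Dirichlet series of the Riemann zeta function; meaningful for 1 < s. *)
Definition zeta {R : realType} (s : R) : R := limn (series (riemannR s)).

(* Main.v *)
(** Let f > 0 be completely multiplicative.  If the sum of f(d) over the divisors
    d > 1 of n is at most 1, then m(n) f(n) <= 1, by induction on the first
    factor.  The condition holds as soon as the product of 1 - f(q) over the
    primes q dividing n is at least 1/2, and zeta(rho) = 2 says that the product
    of 1 - p^-rho over all primes equals 1/2.

    Choose j with 2^(j rho) of the order of log n, and put u = 2^(j(1-rho)) / j;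
    by Chebyshev this is the order of the sum of p^-rho over the primes p > 2^j.
    - If n has at most kappa 2^j / j prime factors above 2^j, its Euler product
      misses enough of the large primes to allow f(d) = d^-(rho - c u).
    - Otherwise take for f(d) the product of d^-(rho + C u) and of one factor 2
      for each prime factor of d above 2^j.  Raising the exponent makes room for
      the doubled primes, and f(n) gains the factor 2^(kappa 2^j / j).
    Both cases give m(n) <= n^rho exp(-c (log n)^(1/rho) / log log n), so that o(n)
    can be 0 for large n.  For the remaining n, o(n) is free, and m(n) < n^rho is
    enough because log log n is positive and different from 1: e^e lies strictly
    between 15 and 16. *)

Require Import Defs.
From mathcomp Require Import all_boot all_order all_algebra.
From mathcomp Require Import finmap.
From mathcomp Require Import all_classical all_reals all_analysis.
From mathcomp Require Import ring lra zify.
Import numFieldNormedType.Exports.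

Set Implicit Arguments.
Unset Strict Implicit.
Unset Printing Implicit Defensive.

Import Order.TTheory GRing.Theory Num.Theory.

(** * Chebyshev's bounds for the number of primes *)

Definition primes_between (a b : nat) : seq nat :=
  [seq p <- index_iota a.+1 b.+1 | prime p].

Lemma mem_primes_between a b p :
  (p \in primes_between a b) = [&& prime p, a < p & p <= b].
Proof. by rewrite mem_filter mem_index_iota ltnS. Qed.

Lemma primes_between_uniq a b : uniq (primes_between a b).
Proof. exact/filter_uniq/iota_uniq. Qed.

Lemma primes_between_cat a b c : a <= b -> b <= c ->
  primes_between a c = primes_between a b ++ primes_between b c.
Proof.
move=> ab bc; rewrite /primes_between -filter_cat /index_iota; congr seq.filter.
have -> : b.+1 = a.+1 + (b.+1 - a.+1) by lia.
by rewrite addKn -iotaD; congr iota; lia.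
Qed.

Lemma dvdn_prod_primes (s : seq nat) N : uniq s -> all prime s ->
  {in s, forall p, p %| N} -> \prod_(p <- s) p %| N.
Proof.
elim: s => [|p s IH] /=; first by rewrite big_nil.
case/andP=> ps us /andP[pp pas] dvd; rewrite big_cons Gauss_dvd.
  by rewrite dvd ?mem_head //= IH // => q qs; rewrite dvd // inE qs orbT.
rewrite prime_coprime // Euclid_dvd_prod // big_has -all_predC.
apply/allP => q qs /=; rewrite dvdn_prime2 ?(allP pas q qs) //.
by apply: contra ps => /eqP ->.
Qed.

Lemma bin_central_le m : 'C(2 * m, m) <= 2 ^ (2 * m).
Proof.
have := Pascal 1 1 (2 * m); rewrite addn1 => ->.
have mi : m < (2 * m).+1 by lia.
rewrite (bigD1 (Ordinal mi)) //= !exp1n !muln1; exact: leq_addr.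
Qed.

(** The base 2 instead of 4 still gives the right order in Chebyshev's lower bound, and the
    induction only needs [m + 1 <= 2m + 1]. *)
Lemma bin_central_ge m : 2 ^ m <= 'C(2 * m, m).
Proof.
have key : 2 ^ m * (m`! * m`!) <= (2 * m)`!.
  elim: m => // m IH; rewrite (_ : 2 * m.+1 = (2 * m).+2); last by lia.
  rewrite !factS expnS.
  have -> : 2 * 2 ^ m * (m.+1 * m`! * (m.+1 * m`!)) =
    (2 * m).+2 * (m.+1 * (2 ^ m * (m`! * m`!))) by lia.
  by rewrite leq_mul2l /=; apply: leq_mul => //; lia.
have mle : m <= 2 * m by lia.
have := bin_fact mle; rewrite (_ : 2 * m - m = m); last by lia.
move=> e; rewrite -e leq_pmul2r ?muln_gt0 ?fact_gt0 // in key.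
Qed.

(** Legendre's formula: the term of [p ^ k] contributes [2m %/ p ^ k - 2 * (m %/ p ^ k)], which is
    at most 1, and is 0 once [p ^ k > 2m]. *)
Lemma logn_bin_central p m : prime p ->
  logn p 'C(2 * m, m) <= trunc_log p (2 * m).
Proof.
move=> pp; have p1 := prime_gt1 pp.
have mle : m <= 2 * m by lia.
have := bin_fact mle; rewrite (_ : 2 * m - m = m); last by lia.
move=> /(congr1 (logn p)); rewrite !lognM ?muln_gt0 ?bin_gt0 ?fact_gt0 //.
rewrite !logn_fact //; set x := logn _ _; set y := bigop _ _ _; set z := bigop _ _ _ => e.
suff : z <= trunc_log p (2 * m) + 2 * y by lia.
rewrite /z {z e}.
(* The two Legendre sums get a common range; the added terms vanish because [p ^ k > m] for
   [k > m]. *)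
have -> : y = \sum_(1 <= k < (2 * m).+1) m %/ p ^ k.
  rewrite /y.
  rewrite [RHS](@big_cat_nat _ _ _ m.+1) //=.
  rewrite [X in _ + X]big_nat [X in _ + X]big1 ?addn0 // => k /andP[mk _].
  by rewrite divn_small // (ltn_trans mk) // ltn_expl.
have cnt T N : \sum_(1 <= k < N.+1) (k <= T) <= T.
  suff: \sum_(1 <= k < N.+1) (k <= T) = minn N T by lia.
  elim: N => [|N IH]; first by rewrite big_geq // min0n.
  by rewrite big_nat_recr //= IH; lia.
apply: leq_trans (_ : \sum_(1 <= k < (2 * m).+1)
  ((k <= trunc_log p (2 * m)) + 2 * (m %/ p ^ k)) <= _); last first.
  by rewrite big_split /= -big_distrr /= leq_add2r.
apply: leq_sum => k _; have pk : 0 < p ^ k by rewrite expn_gt0 ltnW.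
case: (leqP (p ^ k) (2 * m)) => h.
  have -> : k <= trunc_log p (2 * m) by apply: trunc_log_max.
  rewrite -ltnS ltn_divLR //= {1}(divn_eq m (p ^ k)).
  have := ltn_pmod m pk; nia.
by rewrite divn_small.
Qed.

(** Every prime power in the factorization of the binomial coefficient is at most [2m], hence so is
    every prime that occurs. *)
Lemma bin_central_le_primes m :
  0 < m -> 'C(2 * m, m) <= (2 * m) ^ size (primes_between 0 (2 * m)).
Proof.
move=> m0; have C0 : 0 < 'C(2 * m, m) by rewrite bin_gt0; lia.
rewrite {1}(prod_prime_decomp C0) prime_decompE big_map /=.
have le1 p : prime p -> p ^ logn p 'C(2 * m, m) <= 2 * m.
  move=> pp; apply: leq_trans (trunc_logP (prime_gt1 pp) _); last by lia.
  by rewrite leq_exp2l ?prime_gt1 // logn_bin_central.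
apply: (@leq_trans (\prod_(p <- primes 'C(2 * m, m)) (2 * m))).
  rewrite !big_seq; apply: leq_prod => p.
  by rewrite mem_primes => /andP[/le1].
rewrite big_const_seq iter_muln_1 count_predT leq_pexp2l //; first by lia.
apply: uniq_leq_size (primes_uniq _) _ => p.
rewrite mem_primes mem_primes_between => /and3P[pp _ pC].
rewrite pp prime_gt0 //=; apply: leq_trans (le1 _ pp).
by rewrite -{1}(expn1 p) leq_exp2l ?prime_gt1 // logn_gt0 mem_primes pp C0.
Qed.

(** Each prime in the dyadic interval divides the central binomial coefficient of [2 ^ i], which is
    at most [2 ^ (2 ^ i.+1)], and each exceeds [2 ^ i]. *)
Lemma card_primes_dyadic_le i :
  i * size (primes_between (2 ^ i) (2 ^ i.+1)) <= 2 ^ i.+1.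
Proof.
set s := primes_between _ _.
have us : uniq s by exact: primes_between_uniq.
have sprime : all prime s.
  by apply/allP => p; rewrite mem_primes_between => /andP[].
have dvd : \prod_(p <- s) p %| 'C(2 * 2 ^ i, 2 ^ i).
  apply: dvdn_prod_primes => // p; rewrite mem_primes_between.
  case/and3P=> pp lp pl.
  have mle : 2 ^ i <= 2 * 2 ^ i by lia.
  have : p %| (2 * 2 ^ i)`! by rewrite dvdn_fact // -expnS prime_gt0.
  rewrite -(bin_fact mle) (_ : 2 * 2 ^ i - 2 ^ i = 2 ^ i); last by lia.
  rewrite !Euclid_dvdM // orbb => /orP[] //.
  by rewrite fact_prod Euclid_dvd_prod // big_has_cond => /hasP[k]; 
   rewrite mem_index_iota /= => /andP[k1 kl] /(dvdn_leq k1); lia.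
have C0 : 0 < 'C(2 * 2 ^ i, 2 ^ i) by rewrite bin_gt0; lia.
have h := leq_trans (dvdn_leq C0 dvd) (bin_central_le _).
rewrite -(@leq_exp2l 2) // expnM [X in _ <= 2 ^ X]expnS; apply: leq_trans h.
rewrite -iter_muln_1 -(count_predT s) -big_const_seq !big_seq.
apply: leq_prod => p; rewrite mem_primes_between => /and3P[_ h _]; exact: ltnW.
Qed.

Lemma card_primes_pow2_ge j : 2 ^ j <= j.+1 * size (primes_between 0 (2 ^ j.+1)).
Proof.
have h : 0 < 2 ^ j by rewrite expn_gt0.
have := leq_trans (bin_central_ge _) (bin_central_le_primes h).
by rewrite -expnS -expnM leq_exp2l.
Qed.

(** The inductive bound and the dyadic one add up to [6 * 2 ^ j / j]. Since [(j + 1) / j <= 4 / 3]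
    from [j = 3] on, multiplying by [j + 1] gives at most [8 * 2 ^ j], so the constant 4 reproduces
    itself. *)
Lemma card_primes_pow2_le j : 2 < j ->
  j * size (primes_between 0 (2 ^ j)) <= 4 * 2 ^ j.
Proof.
elim: j => // j IH; rewrite ltnS leq_eqVlt => /orP[/eqP<-|j2]; first by vm_compute.
rewrite (@primes_between_cat _ (2 ^ j)) ?leq_exp2l // size_cat.
have := card_primes_dyadic_le j; have := IH j2; rewrite expnS; nia.
Qed.

(** Five doublings let the lower bound [16 * 2 ^ j / (j + 5)] beat the upper bound [4 * 2 ^ j / j]
    with [2 ^ j / j] to spare: otherwise [16 * j <= 5 * (j + 5)], which fails for [j > 2]. *)
Lemma card_primes_window_ge j : 2 < j ->
  2 ^ j <= j * size (primes_between (2 ^ j) (2 ^ (j + 5))).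
Proof.
move=> j2; have := card_primes_pow2_ge (j + 4); have := card_primes_pow2_le j2.
rewrite -addnS (@primes_between_cat 0 (2 ^ j) (2 ^ (j + 5))); last 2 first.
- by [].
- by rewrite leq_exp2l ?leq_addr.
rewrite size_cat expnD; set x := size _; set y := size _; set t := 2 ^ j => xt.
move=> /(leq_mul (leqnn j)) h; rewrite leqNgt; apply/negP => yt.
have t0 : 0 < t by rewrite expn_gt0.
have e1 : (j + 5) * (j * x) <= (j + 5) * (4 * t) by rewrite leq_mul2l xt orbT.
have e2 : (j + 5) * (j * y) <= (j + 5) * t by rewrite leq_mul2l ltnW ?orbT.
have e3 : j * (t * 16) <= (j + 5) * (5 * t).
  by apply: leq_trans h _; move: e1 e2; nia.
have : (16 * j) * t <= ((j + 5) * 5) * t by move: e3; lia.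
by rewrite leq_pmul2r //; lia.
Qed.

Local Open Scope classical_set_scope.
Local Open Scope ring_scope.

(** * Weighted counting of ordered factorizations *)

Lemma ler_sum_sub (R : numDomainType) (I : eqType) (s t : seq I) (F : I -> R) :
  uniq s -> {subset s <= t} -> (forall i, i \in t -> 0 <= F i) ->
  \sum_(i <- s) F i <= \sum_(i <- t) F i.
Proof.
elim: s t => [|a s IH] t /=.
  by move=> _ _ F0; rewrite big_nil big_seq sumr_ge0.
move=> /andP[as_ us] st F0; have at_ : a \in t by rewrite st ?mem_head.
rewrite big_cons (perm_big _ (perm_to_rem at_)) big_cons lerD2l; apply: IH => //.
  move=> i is_; rewrite rem_mem // ?st ?inE ?is_ ?orbT //.
  by apply: contraNneq as_ => <-.
by move=> i /mem_rem/F0.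
Qed.

Lemma ler_prod_sub (R : numDomainType) (I : eqType) (s t : seq I) (F : I -> R) :
  uniq s -> {subset s <= t} -> (forall i, i \in t -> 0 <= F i <= 1) ->
  \prod_(i <- t) F i <= \prod_(i <- s) F i.
Proof.
elim: s t => [|a s IH] t /=.
  by move=> _ _ F0; rewrite big_nil big_seq prodr_ile1.
move=> /andP[as_ us] st F0; have at_ : a \in t by rewrite st ?mem_head.
rewrite big_cons (perm_big _ (perm_to_rem at_)) big_cons.
rewrite ler_wpM2l //; first by case/andP: (F0 _ at_).
apply: IH => //.
  move=> i is_; rewrite rem_mem // ?st ?inE ?is_ ?orbT //.
  by apply: contraNneq as_ => <-.
by move=> i /mem_rem/F0.
Qed.

(* [k] is fuel: [n <= k] suffices. *)
Fixpoint factorizations (k n : nat) : seq (seq nat) :=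
  if n == 1%N then [:: [::]] else
  if k is k'.+1 then
    [seq d :: t | d <- [seq d <- divisors n | (1 < d)%N],
                  t <- factorizations k' (n %/ d)]
  else [::].

Lemma mem_factorizations (k n : nat) (s : seq nat) : (0 < n <= k)%N ->
  (forall d, d \in s -> (2 <= d)%N) -> (\prod_(d <- s) d)%N = n ->
  s \in factorizations k n.
Proof.
elim: k n s => [|k IH] n s /andP[n0 nk]; first by move: n0; lia.
case: s => [|d s] s2; rewrite ?big_nil ?big_cons => e; rewrite /=.
  by rewrite -e.
have d2 : (2 <= d)%N by rewrite s2 ?mem_head.
have p0 : (0 < \prod_(d <- s) d)%N by move: n0; rewrite -e; case: (\prod_(_ <- _) _)%N; lia.
have -> : (n == 1%N) = false by apply/eqP; rewrite -e; nia.
apply/allpairsPdep; exists d, s; split => //.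
  by rewrite mem_filter -dvdn_divisors // -e dvdn_mulr // d2.
apply: IH; last 1 first.
- by rewrite -e mulKn //; lia.
- by rewrite -e mulKn ?p0 /=; [move: nk; rewrite -e; nia | lia].
- by move=> q qs; rewrite s2 // inE qs orbT.
Qed.

(** An inequality, since for [n = 1] the list contains the empty factorization, which [m] does not
    count. *)
Lemma m_le_factorizations (n : nat) : (0 < n)%N ->
  (m n <= size (factorizations n n))%N.
Proof.
move=> n0; rewrite /m; apply: uniq_leq_size; first exact: fset_uniq.
move=> s; rewrite in_fset_set; last exact: finite_ordered_factorizations.
rewrite inE => -[_ s2 e]; apply: mem_factorizations => //.
by rewrite n0 leqnn.
Qed.

Section CompletelyMultiplicative.
Variables (R : realFieldType) (f : nat -> R).
Hypothesis f1 : f 1%N = 1.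
Hypothesis fM : forall a b, (0 < a)%N -> (0 < b)%N -> f (a * b)%N = f a * f b.
Hypothesis f_ge0 : forall a, (0 < a)%N -> 0 <= f a.

Lemma size_factorizations_rec (k n : nat) : (1 < n)%N ->
  (size (factorizations k.+1 n))%:R * f n =
  \sum_(d <- divisors n | (1 < d)%N)
     f d * ((size (factorizations k (n %/ d)))%:R * f (n %/ d)%N).
Proof.
move=> n1; rewrite /=; have -> : (n == 1%N) = false by lia.
rewrite size_allpairs_dep sumnE big_map big_filter natr_sum mulr_suml.
rewrite [LHS]big_seq_cond [RHS]big_seq_cond; apply: eq_bigr => d /andP[].
rewrite -dvdn_divisors ?(ltnW n1) //.
move=> dn d1; rewrite mulrCA -fM ?(ltnW d1) //.
  by rewrite [(d * _)%N]mulnC divnK.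
by rewrite divn_gt0 ?(ltnW d1) // dvdn_leq // ltnW.
Qed.

(** The induction runs over all divisors of a fixed [N]: the divisor sum of each is part of that of
    [N], so one hypothesis serves every cofactor. *)
Lemma size_factorizations_le1 (N : nat) : (0 < N)%N ->
  \sum_(d <- divisors N | (1 < d)%N) f d <= 1 ->
  forall k n, (n %| N)%N -> (size (factorizations k n))%:R * f n <= 1.
Proof.
move=> N0 le1; elim=> [|k IH] n nN.
  by rewrite /=; case: eqP => [->|_] /=; rewrite ?mul1r ?mul0r ?f1 ?ler01 ?lexx.
have n0 : (0 < n)%N by rewrite (dvdn_gt0 N0).
case: (ltngtP n 1%N) => [|n1|->]; first by lia.
  rewrite size_factorizations_rec //; apply: le_trans le1.
  apply: (@le_trans _ _ (\sum_(d <- divisors n | (1 < d)%N) f d)).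
    rewrite [leLHS]big_seq_cond [leRHS]big_seq_cond; apply: ler_sum => d /andP[].
    rewrite -dvdn_divisors // => dn d1.
    rewrite -[leRHS]mulr1 ler_wpM2l ?f_ge0 ?(ltnW d1) // IH //.
    exact: dvdn_trans (dvdn_div dn) nN.
  rewrite -big_filter -[leRHS]big_filter; apply: ler_sum_sub.
  - exact/filter_uniq/divisors_uniq.
  - move=> d; rewrite !mem_filter -!dvdn_divisors // => /andP[-> dn] /=.
    exact: dvdn_trans dn nN.
  - by move=> d; rewrite mem_filter => /andP[d1 _]; rewrite f_ge0 // ltnW.
by rewrite f1 mulr1; case: (k.+1).
Qed.

(** Keeping the divisor sum on the right, instead of 1, later yields the strict inequality
    [m_lt_powR]. *)
Lemma m_mul_le_sum_divisors (n : nat) : (1 < n)%N ->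
  \sum_(d <- divisors n | (1 < d)%N) f d <= 1 ->
  (m n)%:R * f n <= \sum_(d <- divisors n | (1 < d)%N) f d.
Proof.
move=> n1 le1; have n0 := ltnW n1.
apply: (@le_trans _ _ ((size (factorizations n n))%:R * f n)).
  by rewrite ler_wpM2r ?f_ge0 // ler_nat m_le_factorizations.
rewrite -[X in factorizations X](prednK n0) size_factorizations_rec //.
rewrite [leLHS]big_seq_cond [leRHS]big_seq_cond; apply: ler_sum => d /andP[].
rewrite -dvdn_divisors // => dn d1.
rewrite -[leRHS]mulr1 ler_wpM2l ?f_ge0 ?(ltnW d1) //.
by apply: (size_factorizations_le1 n0) => //; exact: dvdn_div.
Qed.

(** Adding the primes of [n] to [l] one by one leads from [f 1] to the full divisor sum. *)
Let smooth_sum (n : nat) (l : seq nat) : R :=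
  \sum_(d <- [seq d <- divisors n | all (mem l) (primes d)]) f d.

(** A divisor prime to [q] is counted in the first term; any other is [q * e] with [e] again a
    divisor over [q :: l]. Equality can fail because [q * e] need not divide [n]. *)
Lemma smooth_sum_cons (n q : nat) (l : seq nat) : (0 < n)%N -> prime q ->
  smooth_sum n (q :: l) <= smooth_sum n l + f q * smooth_sum n (q :: l).
Proof.
move=> n0 qp; rewrite {1}/smooth_sum (bigID (fun d => ~~ (q %| d)%N)) /=.
apply: lerD.
  rewrite -big_filter; apply: ler_sum_sub.
  - exact/filter_uniq/filter_uniq/divisors_uniq.
  - move=> d; rewrite !mem_filter => /and3P[qd /allP al ->]; rewrite andbT.
    apply/allP => p pd /=; move/al: (pd); rewrite /= inE => /orP[/eqP epq|//].
    by case/negP: qd; move: pd; rewrite epq mem_primes => /and3P[].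
  - move=> d; rewrite mem_filter -dvdn_divisors // => /andP[_ dn].
    by rewrite f_ge0 // (dvdn_gt0 n0).
set D := divisors n; set Q := fun d => all (mem (q :: l)) (primes d).
rewrite -big_filter /=.
set s := [seq d <- _ | _].
have sP d : d \in s -> [/\ (0 < d)%N, (q %| d)%N, d \in D & Q d].
  rewrite !mem_filter negbK => /and3P[qd Qd dD]; split=> //.
  by move: dD; rewrite -dvdn_divisors // => /(dvdn_gt0 n0).
have q0 := prime_gt0 qp.
rewrite (@eq_big_seq _ _ _ _ _ _ (fun d => f q * f (d %/ q)%N)); last first.
  move=> d /sP[d0 qd _ _]; rewrite -fM //; last by rewrite divn_gt0 // dvdn_leq.
  by rewrite mulnC divnK.
rewrite -mulr_sumr ler_wpM2l ?f_ge0 //.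
rewrite -(big_map (fun d => d %/ q)%N xpredT f); apply: ler_sum_sub.
- rewrite map_inj_in_uniq ?filter_uniq ?divisors_uniq // => a b /sP[_ qa _ _] /sP[_ qb _ _].
  by move=> /(congr1 (muln^~ q)); rewrite /= !divnK.
- move=> e /mapP[d /sP[d0 qd dD Qd] ->]; rewrite mem_filter.
  move: dD; rewrite -!dvdn_divisors // => dn.
  rewrite (dvdn_trans (dvdn_div qd) dn) andbT; apply/allP => p.
  rewrite mem_primes => /and3P[pp _ pd]; apply: (allP Qd).
  by rewrite mem_primes pp d0 (dvdn_trans pd (dvdn_div qd)).
- move=> d; rewrite mem_filter -dvdn_divisors // => /andP[_ dn].
  by rewrite f_ge0 // (dvdn_gt0 n0).
Qed.

(** The divisor sum is at most the Euler product over the primes of [n]; this form without division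
    allows [f q = 1]. *)
Lemma sum_divisors_mul_prod_le1 (n : nat) : (0 < n)%N ->
  (forall q, q \in primes n -> f q <= 1) ->
  (\sum_(d <- divisors n) f d) * \prod_(q <- primes n) (1 - f q) <= 1.
Proof.
move=> n0 fle1.
have key l : uniq l -> {subset l <= primes n} ->
    smooth_sum n l * \prod_(q <- l) (1 - f q) <= 1.
  elim: l => [_ _|q l IH /= /andP[_ ul] sub].
    rewrite big_nil mulr1 -f1 /smooth_sum.
    have -> : [seq d <- divisors n | all (mem [::]) (primes d)] = [:: 1%N].
      apply: (irr_sorted_eq ltn_trans ltnn) => //.
        exact/sorted_filter/sorted_divisors_ltn/ltn_trans.
      move=> d; rewrite mem_filter inE -dvdn_divisors //.
      case: (posnP d) => [->|d0]; first by rewrite dvd0n (gtn_eqF n0) andbF.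
      have -> : all (mem [::]) (primes d) = (primes d == [::]) by case: (primes d).
      rewrite primes_eq0; case: (ltngtP d 1%N) => [|d1|->]; last by rewrite dvd1n.
        by rewrite ltnNge d0.
      by rewrite ltnNge d1.
    by rewrite big_seq1.
  have qn : q \in primes n by rewrite sub ?mem_head.
  have qp : prime q by move: qn; rewrite mem_primes => /and3P[].
  rewrite big_cons mulrA; apply: le_trans (IH ul _); last first.
    by move=> x xl; rewrite sub // inE xl orbT.
  rewrite ler_wpM2r //.
    rewrite big_seq prodr_ge0 // => x xl; rewrite subr_ge0 fle1 // sub //.
    by rewrite inE xl orbT.
  have := smooth_sum_cons l n0 qp; rewrite mulrBr mulr1; lra.
have := key _ (primes_uniq n) (fun _ => id); rewrite /smooth_sum.
suff -> : [seq d <- divisors n | all (mem (primes n)) (primes d)] = divisors n by [].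
apply/all_filterP/allP => d; rewrite -dvdn_divisors // => dn.
apply/allP => p /=; rewrite !mem_primes => /and3P[-> _ pd].
by rewrite n0 (dvdn_trans pd dn).
Qed.

(** The full divisor sum is at most 2, and the divisor 1 accounts for [f 1 = 1] of it. *)
Lemma m_mul_le1 (n : nat) : (1 < n)%N ->
  (forall q, q \in primes n -> f q <= 1) ->
  1 / 2 <= \prod_(q <- primes n) (1 - f q) -> (m n)%:R * f n <= 1.
Proof.
move=> n1 fle1 half; have n0 := ltnW n1.
have le1 : \sum_(d <- divisors n | (1 < d)%N) f d <= 1.
  have := sum_divisors_mul_prod_le1 n0 fle1.
  rewrite (bigID (fun d => 1 < d)%N) /=.
  set S := \sum_(_ <- _ | _) _; set T := \sum_(_ <- _ | _) _.
  have T1 : 1 <= T.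
    have -> : 1 = \sum_(d <- [:: 1%N]) f d by rewrite big_seq1 f1.
    rewrite /T -[leRHS]big_filter; apply: ler_sum_sub => //.
      by move=> d; rewrite inE => /eqP->; rewrite mem_filter divisor1.
    move=> d; rewrite mem_filter -dvdn_divisors // => /andP[_ dn].
    by rewrite f_ge0 // (dvdn_gt0 n0).
  have S0 : 0 <= S.
    by apply: sumr_ge0 => d d1; rewrite f_ge0 // ltnW.
  nra.
exact: le_trans (m_mul_le_sum_divisors n1 le1) le1.
Qed.

End CompletelyMultiplicative.

(** * The Euler product and sums over primes *)

Section EulerProduct.
Variables (R : realType) (f : nat -> R).
Hypothesis f1 : f 1%N = 1.
Hypothesis fM : forall a b, (0 < a)%N -> (0 < b)%N -> f (a * b)%N = f a * f b.
Hypothesis f_gt0 : forall a, (0 < a)%N -> 0 < f a.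

(** The infinite sum over integers with all prime factors in [l] is handled as a supremum of these
    truncations. *)
Let smooth_upto (l : seq nat) (X : nat) : R :=
  \sum_(d <- [seq d <- iota 1 X | all (mem l) (primes d)]) f d.

(** The integers over [l] are prime to [q], hence disjoint from the multiples [q * e]; the cutoff
    [q * (X + Y)] contains both kinds. *)
Lemma smooth_upto_cons (q : nat) (l : seq nat) (X Y : nat) :
  prime q -> q \notin l ->
  smooth_upto l X + f q * smooth_upto (q :: l) Y <=
  smooth_upto (q :: l) (q * (X + Y)).
Proof.
move=> qp ql; have q0 := prime_gt0 qp.
rewrite /smooth_upto mulr_sumr.
set s := [seq d <- _ | _]; set t := [seq d <- _ | _]; set u := [seq d <- _ | _].
have tP e : e \in t -> [/\ (0 < e)%N, (e <= Y)%N & all (mem (q :: l)) (primes e)].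
  by rewrite mem_filter mem_iota => /and3P[-> -> h]; split => //; move: h; rewrite add1n ltnS.
rewrite (@eq_big_seq _ _ _ _ t _ (fun d => f (q * d)%N)); last first.
  by move=> d /tP[d0 _ _]; rewrite fM.
rewrite -(big_map (fun d => q * d)%N xpredT f) -big_cat; apply: ler_sum_sub.
- rewrite cat_uniq filter_uniq ?iota_uniq //=.
  rewrite map_inj_in_uniq ?filter_uniq ?iota_uniq ?andbT //; last first.
    by move=> a b _ _ /eqP; rewrite eqn_pmul2l // => /eqP.
  apply/hasPn => d /mapP[e /tP[e0 _ _] ->]; rewrite mem_filter negb_and.
  apply/orP; left; apply: contra ql => /allP; apply.
  by rewrite mem_primes qp dvdn_mulr // muln_gt0 q0 e0.
- move=> d; rewrite mem_cat => /orP[|/mapP[e /tP[e0 eY al] ->]].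
    rewrite !mem_filter !mem_iota => /and3P[/allP al -> dX] /=.
    apply/andP; split; last by move: dX; rewrite !add1n !ltnS; nia.
    by apply/allP => p /al /=; rewrite inE => ->; rewrite orbT.
  rewrite mem_filter mem_iota muln_gt0 q0 e0 /= add1n ltnS leq_mul2l.
  rewrite (leq_trans eY (leq_addl _ _)) orbT andbT.
  apply/allP => p /=; rewrite mem_primes => /and3P[pp _].
  rewrite Euclid_dvdM // dvdn_prime2 // inE => /orP[->//|pe].
  by have := allP al p; rewrite mem_primes pp e0 pe /= inE; apply.
- by move=> d; rewrite mem_filter mem_iota => /and3P[_ d0 _]; rewrite ltW ?f_gt0.
Qed.

(** Removing a prime [q] from [l] improves the bound on the smooth sums from [V] to [V * (1 - f q)];
    with no prime left the sum is [f 1 = 1]. *)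
Lemma euler_product_ge (V : R) (l : seq nat) : uniq l -> all prime l ->
  (forall q, q \in l -> f q <= 1) ->
  (forall X, \sum_(d <- iota 1 X) f d <= V) ->
  1 <= V * \prod_(q <- l) (1 - f q).
Proof.
move=> ul pl fle bnd.
have {bnd} : forall X, smooth_upto l X <= V.
  move=> X; apply: le_trans (bnd X); apply: ler_sum_sub.
  - exact/filter_uniq/iota_uniq.
  - by move=> d; rewrite mem_filter => /andP[].
  - by move=> d; rewrite mem_iota => /andP[d0 _]; rewrite ltW ?f_gt0.
elim: l ul pl fle V => [|q l IH] /=.
  move=> _ _ _ V /(_ 1%N); rewrite big_nil mulr1; apply: le_trans.
  by rewrite /smooth_upto /= big_seq1 f1.
move=> /andP[ql ul] /andP[qp pl] fle V bnd.
rewrite big_cons mulrA; apply: IH => //.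
  by move=> p pl'; rewrite fle // inE pl' orbT.
move=> X.
have hs : has_sup (range (smooth_upto (q :: l))).
  by split; [exists (smooth_upto (q :: l) 0%N), 0%N | exists V => _ [Y _ <-]].
set S := sup (range (smooth_upto (q :: l))).
have SV : S <= V by apply: ge_sup => [|_ [Y _ <-]//]; case: hs.
have fq : 0 < f q by rewrite f_gt0 ?prime_gt0.
have fq1 : f q <= 1 by rewrite fle ?mem_head.
(* With [X] fixed and [Y] arbitrary, [smooth_upto_cons] gives [smooth_upto l X <= (1 - f q) * S]. *)
have : S <= (S - smooth_upto l X) / f q.
  apply: ge_sup; first by case: hs.
  move=> _ [Y _ <-]; rewrite ler_pdivlMr // lerBrDl mulrC.
  apply: le_trans (smooth_upto_cons _ _ qp ql) _.
  by apply: ub_le_sup; [case: hs | exists (q * (X + Y))%N].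
rewrite ler_pdivlMr // => h; nra.
Qed.

End EulerProduct.

(** * Sums of [d^-s] over integers and over primes *)

Section DirichletSums.
Variable R : realType.
Implicit Types (s : R) (d i j k : nat).

Lemma powRN_natM s (a b : nat) :
  (a * b)%:R `^ (- s) = a%:R `^ (- s) * b%:R `^ (- s) :> R.
Proof. by rewrite natrM powRM. Qed.

Lemma powRN_nat_gt0 s (a : nat) : (0 < a)%N -> 0 < a%:R `^ (- s) :> R.
Proof. by move=> a0; rewrite powR_gt0 // ltr0n. Qed.

Lemma ler_powRN_nat s (a b : nat) : 0 <= s -> (0 < a <= b)%N ->
  b%:R `^ (- s) <= a%:R `^ (- s) :> R.
Proof.
move=> s0 /andP[a0 ab]; rewrite !powRN lef_pV2 ?posrE ?powR_gt0 ?ltr0n //; last by lia.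
by rewrite ge0_ler_powR ?nnegrE // ler_nat.
Qed.

Lemma powRN_nat_lt1 s (a : nat) : 0 < s -> (1 < a)%N -> a%:R `^ (- s) < 1 :> R.
Proof.
move=> s0 a1; rewrite powRN invf_lt1 ?powR_gt0 ?ltr0n ?(ltnW a1) //.
have : 1 `^ s < a%:R `^ s :> R by rewrite gt0_ltr_powR ?nnegrE ?ltr1n.
by rewrite powR1.
Qed.

Lemma powRN_pow2 s i :
  (2 ^ i)%:R * (2 ^ i)%:R `^ (- s) = (2 `^ (1 - s)) ^+ i :> R.
Proof.
rewrite -powR_mulrn ?powR_ge0 // -powRrM mulrC [(1 - s) * _]mulrC powRrM.
rewrite natrX -powR_mulrn // powRD ?powRr1 ?powR_ge0 // 1?mulrC //.
by apply/implyP; rewrite powR_eq0 pnatr_eq0.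
Qed.

Lemma powR2_lt1 s : 1 < s -> (0 : R) < 2 `^ (1 - s) < 1.
Proof.
move=> s1; rewrite powR_gt0 //=; have := @powRN_nat_lt1 (s - 1) 2.
by rewrite opprB; apply => //; rewrite subr_gt0.
Qed.

Lemma sum_powRN_bound s : 1 < s ->
  forall X, \sum_(d <- iota 1 X) d%:R `^ (- s) <= (1 - 2 `^ (1 - s))^-1 :> R.
Proof.
move=> s1 X; have /andP[x0 x1] := powR2_lt1 s1; set x := 2 `^ (1 - s) in x0 x1 *.
have key k : (1 - x) * \sum_(1 <= d < 2 ^ k) d%:R `^ (- s) <= 1 - x ^+ k.
  elim: k => [|k IH]; first by rewrite big_geq ?expr0 ?mulr0 ?subrr.
  rewrite (@big_cat_nat _ _ _ (2 ^ k)) /= ?expn_gt0 ?leq_exp2l // mulrDr.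
  suff : (1 - x) * \sum_(2 ^ k <= d < 2 ^ k.+1) d%:R `^ (- s) <= x ^+ k - x ^+ k.+1 by lra.
  have -> : x ^+ k - x ^+ k.+1 = (1 - x) * x ^+ k by rewrite exprS; ring.
  rewrite ler_wpM2l ?subr_ge0 ?(ltW x1) //.
  rewrite -powRN_pow2.
  apply: (@le_trans _ _ (\sum_(2 ^ k <= d < 2 ^ k.+1) (2 ^ k)%:R `^ (- s))).
    apply: ler_sum_nat => d /andP[kd _]; rewrite ler_powRN_nat ?expn_gt0 //; lra.
  by rewrite sumr_const_nat mulr_natl expnS mul2n -addnn addnK.
rewrite -[leRHS]mul1r ler_pdivlMr ?subr_gt0 // mulrC.
apply: le_trans (_ : 1 - x ^+ X <= _); last by rewrite lerBlDr lerDl exprn_ge0 // ltW.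
apply: le_trans (key X); rewrite ler_wpM2l ?subr_ge0 ?(ltW x1) //.
apply: ler_sum_sub; rewrite ?iota_uniq // => d.
  rewrite mem_index_iota mem_iota => /andP[-> h]; have := ltn_expl X (ltnSn 1); lia.
Qed.


Lemma zeta_partial_lt s : 1 < s ->
  forall X, \sum_(d <- iota 1 X) d%:R `^ (- s) < zeta s.
Proof.
move=> s1 X.
(* [riemannR s] has the term of the integer 1 at index 0. *)
have seriesE k : series (riemannR s) k = \sum_(d <- iota 1 k) d%:R `^ (- s).
  rewrite seriesEnat /= -(addn0 1%N) iotaDl big_map /index_iota subn0.
  by apply: eq_bigr => d _; rewrite powRN.
have nd : nondecreasing_seq (series (riemannR s)).
  apply/nondecreasing_seqP => k; rewrite seriesSr lerDl ltW //.
  by rewrite riemannR_gt0 //; lra.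
have cv : cvgn (series (riemannR s)).
  apply: nondecreasing_is_cvgn => //.
  exists ((1 - 2 `^ (1 - s))^-1) => _ [k _ <-]; rewrite seriesE.
  exact: sum_powRN_bound.
have : series (riemannR s) X.+1 <= zeta s by exact: nondecreasing_cvgn_le.
apply: lt_le_trans; rewrite -seriesE seriesSr ltrDl riemannR_gt0 //; lra.
Qed.

Lemma zeta_euler_product_ge s N : 1 < s -> zeta s = 2 ->
  1 / 2 <= \prod_(q <- primes_between 0 N) (1 - q%:R `^ (- s)) :> R.
Proof.
move=> s1 z2; have s0 : 0 < s by lra.
have h : 1 <= 2 * \prod_(q <- primes_between 0 N) (1 - q%:R `^ (- s)) :> R.
  apply: (@euler_product_ge _ (fun d => d%:R `^ (- s))).
  - by rewrite powR1.
  - by move=> a b _ _; rewrite powRN_natM.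
  - by move=> a a0; rewrite powRN_nat_gt0.
  - exact: primes_between_uniq.
  - by apply/allP => p; rewrite mem_primes_between => /andP[].
  - move=> q; rewrite mem_primes_between => /and3P[/prime_gt1 q1 _ _].
    by rewrite ltW // powRN_nat_lt1.
  - by move=> X; rewrite -z2 ltW // zeta_partial_lt.
lra.
Qed.

(** By Chebyshev the dyadic block at [2 ^ i] contributes at most [2 * x ^+ i / i], hence at most
    [2 * x ^+ i / j]; the geometric sum telescopes after multiplication by [1 - x]. *)
Lemma sum_primes_powRN_le s j k : 1 < s -> (0 < j <= k)%N ->
  \sum_(p <- primes_between (2 ^ j) (2 ^ k)) p%:R `^ (- s) <=
  2 / (1 - 2 `^ (1 - s)) * ((2 `^ (1 - s)) ^+ j / j%:R) :> R.
Proof.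
move=> s1 /andP[j0 jk].
have /andP[x0 x1] := powR2_lt1 s1; set x := 2 `^ (1 - s) in x0 x1 *.
have j0' : 0 < j%:R :> R by rewrite ltr0n.
suff key : (1 - x) * (j%:R * \sum_(p <- primes_between (2 ^ j) (2 ^ k)) p%:R `^ (- s))
    <= 2 * (x ^+ j - x ^+ k).
  have xk : 0 <= x ^+ k by rewrite exprn_ge0 // ltW.
  have -> : 2 / (1 - x) * (x ^+ j / j%:R) = 2 * x ^+ j / ((1 - x) * j%:R).
    by rewrite invfM !mulrA; congr (_ * _); rewrite mulrAC.
  rewrite ler_pdivlMr ?mulr_gt0 ?subr_gt0 //; lra.
elim: k jk => [|k IH]; first by lia.
rewrite leq_eqVlt => /orP[/eqP<-|].
  by rewrite /primes_between /index_iota subnn big_nil subrr !mulr0.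
rewrite ltnS => jk; rewrite (@primes_between_cat _ (2 ^ k)) ?leq_exp2l //.
rewrite big_cat /= !mulrDr.
suff : (1 - x) * (j%:R * \sum_(p <- primes_between (2 ^ k) (2 ^ k.+1)) p%:R `^ (- s))
    <= 2 * (x ^+ k - x ^+ k.+1) by have := IH jk; lra.
have -> : 2 * (x ^+ k - x ^+ k.+1) = (1 - x) * (2 * x ^+ k) by rewrite exprS; ring.
rewrite ler_wpM2l ?subr_ge0 ?(ltW x1) //.
set l := primes_between _ _.
apply: (@le_trans _ _ (j%:R * ((size l)%:R * (2 ^ k)%:R `^ (- s)))).
  rewrite ler_wpM2l //; apply: (@le_trans _ _ (\sum_(p <- l) (2 ^ k)%:R `^ (- s))).
    rewrite !big_seq; apply: ler_sum => p; rewrite mem_primes_between => /and3P[_ h _].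
    by rewrite ler_powRN_nat ?expn_gt0 ?(ltnW h) //; lra.
  by rewrite big_const_seq count_predT iter_addr_0 mulr_natl.
rewrite -powRN_pow2 !mulrA ler_wpM2r ?powR_ge0 // -!natrM ler_nat.
rewrite -expnS; apply: leq_trans (card_primes_dyadic_le k).
by rewrite leq_mul2r jk orbT.
Qed.

Lemma sum_primes_powRN_ge s j : 0 < s -> (2 < j)%N ->
  32 `^ (- s) * ((2 `^ (1 - s)) ^+ j / j%:R) <=
  \sum_(p <- primes_between (2 ^ j) (2 ^ (j + 5))) p%:R `^ (- s) :> R.
Proof.
move=> s0 j2; have j0' : 0 < j%:R :> R by rewrite ltr0n; lia.
rewrite mulrA ler_pdivrMr // -powRN_pow2.
apply: (@le_trans _ _ ((size (primes_between (2 ^ j) (2 ^ (j + 5))))%:R *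
  (2 ^ (j + 5))%:R `^ (- s) * j%:R)).
  have := card_primes_window_ge j2; rewrite -(ler_nat R) natrM.
  rewrite expnD powRN_natM; set z := (size _)%:R => h.
  have -> : z * ((2 ^ j)%:R `^ (- s) * (2 ^ 5)%:R `^ (- s)) * j%:R =
    32 `^ (- s) * (2 ^ j)%:R `^ (- s) * (j%:R * z) :> R by ring.
  by rewrite mulrCA mulrC ler_wpM2l // mulr_ge0 ?powR_ge0.
rewrite ler_wpM2r //; set l := primes_between _ _.
apply: (@le_trans _ _ (\sum_(p <- l) (2 ^ (j + 5))%:R `^ (- s))).
  by rewrite big_const_seq count_predT iter_addr_0 mulr_natl.
rewrite !big_seq; apply: ler_sum => p; rewrite mem_primes_between => /and3P[pp _ h].
by rewrite ler_powRN_nat ?h ?prime_gt0 // ltW.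
Qed.

End DirichletSums.

(** * Integers with few large prime factors *)

Section ProductBounds.
Variables (R : realFieldType) (I : eqType).
Implicit Types (l : seq I) (F : I -> R).

Lemma prod_1B_ge l F : (forall i, i \in l -> 0 <= F i <= 1) ->
  1 - \sum_(i <- l) F i <= \prod_(i <- l) (1 - F i).
Proof.
elim: l => [|a l IH] h; first by rewrite !big_nil subr0.
have /andP[a0 a1] := h a (mem_head _ _).
have hl i : i \in l -> 0 <= F i <= 1 by move=> il; apply: h; rewrite inE il orbT.
have S0 : 0 <= \sum_(i <- l) F i.
  by rewrite big_seq sumr_ge0 // => i /hl/andP[].
rewrite !big_cons; have := IH hl; nra.
Qed.

(** Induction through [(1 - a) * (1 + a + S) <= 1 + S] for [a] and [S] nonnegative. *)
Lemma prod_1B_le l F : (forall i, i \in l -> 0 <= F i <= 1) ->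
  \prod_(i <- l) (1 - F i) * (1 + \sum_(i <- l) F i) <= 1.
Proof.
elim: l => [|a l IH] h; first by rewrite !big_nil addr0 mulr1.
have /andP[a0 a1] := h a (mem_head _ _).
have hl i : i \in l -> 0 <= F i <= 1 by move=> il; apply: h; rewrite inE il orbT.
have S0 : 0 <= \sum_(i <- l) F i.
  by rewrite big_seq sumr_ge0 // => i /hl/andP[].
have P0 : 0 <= \prod_(i <- l) (1 - F i).
  by rewrite big_seq prodr_ge0 // => i /hl/andP[_]; rewrite subr_ge0.
rewrite !big_cons; apply: le_trans (IH hl).
rewrite -mulrA mulrCA ler_wpM2l //; nra.
Qed.

End ProductBounds.

(** Young's inequality with conjugate exponents [(1 - t)^-1] and [t^-1]. *)
Lemma powRN_convex (R : realType) (a b t : R) (d : nat) : (0 < d)%N -> 0 < t < 1 ->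
  d%:R `^ (- ((1 - t) * a + t * b)) <=
  (1 - t) * d%:R `^ (- a) + t * d%:R `^ (- b) :> R.
Proof.
move=> d0 /andP[t0 t1]; have d0' : d%:R != 0 :> R by rewrite pnatr_eq0 -lt0n.
have t1' : 0 < 1 - t by rewrite subr_gt0.
have := @conjugate_powR R ((d%:R `^ (- a)) `^ (1 - t)) ((d%:R `^ (- b)) `^ t)
  (1 - t)^-1 t^-1.
rewrite -!powRrM -powRD ?d0' ?implybT // !mulfK ?gt_eqF // !invrK => h.
rewrite opprD -!mulNr [(- _) * a]mulNr -mulrN mulrC mulNr -mulrN [t * _]mulrC.
rewrite [leRHS]addrC addrC [(1 - t) * _]mulrC [t * _]mulrC.
by rewrite addrC [leRHS]addrC; apply: h; rewrite ?powR_ge0 ?invr_gt0 ?subrK.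
Qed.

Lemma powRN_nat_le_half (R : realType) (s : R) (q : nat) : 1 <= s -> (1 < q)%N ->
  q%:R `^ (- s) <= 1 / 2 :> R.
Proof.
move=> s1 q1; apply: (@le_trans _ _ (2 `^ (- s))).
  by apply: (@ler_powRN_nat _ _ 2) => //; lra.
rewrite powRN div1r lef_pV2 ?posrE ?powR_gt0 //.
by rewrite -[leLHS]powRr1 // ler_powR // ler1n.
Qed.

(** Up to [y], replacing the primes of [n] by all primes only lowers the product; above [y],
    [prod_1B_ge] applies. *)
Lemma prod_primes_split (R : realFieldType) (n y : nat) (F : nat -> R) : (0 < n)%N ->
  (forall q, (1 < q)%N -> 0 <= F q <= 1) ->
  \prod_(p <- primes_between 0 y) (1 - F p) *
    (1 - \sum_(q <- primes n | (y < q)%N) F q) <=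
  \prod_(q <- primes n) (1 - F q).
Proof.
move=> n0 F01.
have Fp q : q \in primes n -> 0 <= F q <= 1.
  by rewrite mem_primes => /and3P[/prime_gt1/F01].
have Gp q : q \in primes n -> 0 <= 1 - F q <= 1.
  by move=> /Fp/andP[? ?]; apply/andP; split; lra.
rewrite [leRHS](bigID (fun q => q <= y)%N) /=.
apply: (@le_trans _ _ (\prod_(p <- primes_between 0 y) (1 - F p) *
    \prod_(q <- primes n | (y < q)%N) (1 - F q))).
  rewrite ler_wpM2l //.
    rewrite big_seq prodr_ge0 // => q; rewrite mem_primes_between.
    by move=> /and3P[/prime_gt1/F01/andP[_]]; rewrite subr_ge0.
  rewrite -big_filter -[leRHS]big_filter; apply: prod_1B_ge => q.
  by rewrite mem_filter => /andP[_ /Fp].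
under [X in _ <= _ * X]eq_bigl => q do rewrite -ltnNge.
rewrite ler_wpM2r //.
  by rewrite big_seq_cond prodr_ge0 // => q /andP[/Gp/andP[]].
rewrite -[leRHS]big_filter; apply: ler_prod_sub.
- exact/filter_uniq/primes_uniq.
- move=> q; rewrite mem_filter mem_primes_between mem_primes.
  by move=> /andP[-> /and3P[pq _ _]]; rewrite pq prime_gt0.
- move=> q; rewrite mem_primes_between => /and3P[/prime_gt1/F01/andP[? ?] _ _].
  by apply/andP; split; lra.
Qed.


Lemma window_term_bounds (R : realType) (rho : R) (j : nat) : 1 < rho -> (0 < j)%N ->
  0 < (2 `^ (1 - rho)) ^+ j / j%:R <= 1.
Proof.
move=> rho1 j0; have /andP[x0 x1] := powR2_lt1 rho1.
have j1 : 1 <= j%:R :> R by rewrite ler1n.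
have jp : 0 < j%:R :> R by lra.
rewrite divr_gt0 ?exprn_gt0 //= ler_pdivrMr // mul1r.
by apply: le_trans j1; rewrite exprn_ile1 // ltW.
Qed.

Lemma m_le_few_large_primes (R : realType) (rho : R) : 1 < rho -> zeta rho = 2 ->
  exists c : R, exists kappa : R,
  [/\ 0 < c, 0 < kappa & forall n j : nat, (1 < n)%N -> (2 < j)%N ->
    (count (fun q => 2 ^ j < q)%N (primes n))%:R <= kappa * ((2 ^ j)%:R / j%:R) ->
    (m n)%:R <= n%:R `^ (rho - c * ((2 `^ (1 - rho)) ^+ j / j%:R))].
Proof.
move=> rho1 zeta_rho; pose x : R := 2 `^ (1 - rho); rewrite -/x.
have half_bound q : (1 < q)%N -> (0 : R) <= q%:R `^ (- rho) <= 1 / 2.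
  by move=> q1; rewrite powR_ge0 powRN_nat_le_half // ltW.
pose s0 : R := (1 + rho) / 2.
have s01 : 1 < s0 by rewrite /s0; lra.
have s0r : s0 < rho by rewrite /s0; lra.
pose C0 : R := (1 - 2 `^ (1 - s0))^-1.
have C01 : 1 <= C0.
  have := sum_powRN_bound s01 1; rewrite /= big_seq1 powR1; exact.
have C0p : 0 < C0 by lra.
pose A : R := 32 `^ (- rho).
have A0 : 0 < A by apply: (@powRN_nat_gt0 _ _ 32).
have A1 : A < 1 by apply: (@powRN_nat_lt1 _ _ 32) => //; lra.
(* With [T = A * u], the value of [kappa] limits the cost of the primes above [2 ^ j] to [T / 4],
   and [8 * C0] limits the cost of the lower exponent to [2 * t * C0 = T / 4]. The primes missing
   from [n] pay for both. *)
exists (A / (8 * C0) * (rho - s0)), (A / 4); split.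
- by rewrite mulr_gt0 ?subr_gt0 // divr_gt0 // mulr_gt0.
- by rewrite divr_gt0.
move=> n j n1 j2 few; have n0 := ltnW n1.
have /andP[u0 u1] := window_term_bounds rho1 (ltnW (ltnW j2)).
have xj : (2 ^ j)%:R / j%:R * (2 ^ j)%:R `^ (- rho) = x ^+ j / j%:R.
  by rewrite mulrAC powRN_pow2.
rewrite -/x in u0 u1; set u := x ^+ j / j%:R in u0 u1 xj *.
pose T : R := A * u.
have T0 : 0 < T by rewrite mulr_gt0.
have T1 : T <= 1 by rewrite /T; nra.
pose t : R := T / (8 * C0).
have tC : t * C0 = T / 8 by rewrite /t invfM mulrA mulfVK // gt_eqF.
have t0 : 0 < t by rewrite divr_gt0 // mulr_gt0.
have t1 : t <= 1 / 8 by nra.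
(* Lowering the exponent along the segment from rho to s0 < rho costs at most
   t q^-s0 at the prime q, which is summable because s0 > 1. *)
pose s : R := (1 - t) * rho + t * s0.
have -> : rho - A / (8 * C0) * (rho - s0) * u = s.
  by rewrite /s /t /T; ring.
have sgt1 : 1 < s by rewrite /s; nra.
have F_half q : (1 < q)%N -> (0 : R) <= q%:R `^ (- s) <= 1 / 2.
  by move=> q1; rewrite powR_ge0 powRN_nat_le_half // ltW.
have G01 q : (1 < q)%N -> 0 <= 2 * t * q%:R `^ (- s0) <= 1.
  move=> q1; have := @powRN_nat_le_half R s0 q (ltW s01) q1.
  have := powR_ge0 (q%:R : R) (- s0); set z := _ `^ _ => z0 z1; nra.
(* The coefficient 2 leaves room for the cross term, since [q^-rho <= 1 / 2]. *)
have factor q : (1 < q)%N ->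
    (1 - q%:R `^ (- rho)) * (1 - 2 * t * q%:R `^ (- s0)) <= 1 - q%:R `^ (- s).
  move=> q1; have t01 : 0 < t < 1 by apply/andP; split; lra.
  have := powRN_convex rho s0 (ltnW q1) t01; rewrite -/s.
  have /andP[] := half_bound q q1; have := powR_ge0 (q%:R : R) (- s0).
  set a := _ `^ (- s0); set b := _ `^ (- rho); set c := _ `^ (- s) => a0 b0 b1 h.
  have : 0 <= t * a * (1 / 2 - b) by apply: mulr_ge0; [apply: mulr_ge0; lra|lra].
  nra.
suff half : 1 / 2 <= \prod_(q <- primes n) (1 - q%:R `^ (- s)).
  have : (m n)%:R * n%:R `^ (- s) <= 1.
    apply: (@m_mul_le1 R (fun d => d%:R `^ (- s))) => //.
    - by rewrite powR1.
    - by move=> a b _ _; rewrite powRN_natM.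
    - by move=> q; rewrite mem_primes => /and3P[/prime_gt1/F_half/andP[_ ?] _ _]; lra.
  by rewrite powRN ler_pdivrMr ?mul1r // powR_gt0 // ltr0n.
have primes_gt1 q : q \in primes n -> (1 < q)%N.
  by rewrite mem_primes => /and3P[/prime_gt1].
apply: (@le_trans _ _ (\prod_(q <- primes n)
    ((1 - q%:R `^ (- rho)) * (1 - 2 * t * q%:R `^ (- s0))))); last first.
  rewrite big_seq [leRHS]big_seq; apply: ler_prod => q /primes_gt1 q1.
  rewrite factor // andbT mulr_ge0 // subr_ge0; first by case/andP: (half_bound q q1); lra.
  by case/andP: (G01 q q1).
rewrite big_split /=.
set P1 := \prod_(_ <- _) _; set P2 := \prod_(_ <- _) _.
have P2_ge : 1 - T / 4 <= P2.
  have P2h : 1 - \sum_(q <- primes n) 2 * t * q%:R `^ (- s0) <= P2.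
    by apply: prod_1B_ge => q /primes_gt1; exact: G01.
  apply: le_trans P2h; rewrite lerD2l lerN2 -mulr_sumr.
  suff : \sum_(q <- primes n) q%:R `^ (- s0) <= C0 by nra.
  apply: le_trans (sum_powRN_bound s01 n); apply: ler_sum_sub; first exact: primes_uniq.
    move=> q; rewrite mem_primes mem_iota => /and3P[/prime_gt0 -> _ /(dvdn_leq n0)].
    by rewrite add1n ltnS.
  by move=> d _; rewrite powR_ge0.
pose P := \prod_(p <- primes_between 0 (2 ^ j)) (1 - p%:R `^ (- rho) : R).
have P0 : 0 <= P.
  rewrite /P big_seq prodr_ge0 // => q; rewrite mem_primes_between.
  by move=> /and3P[/prime_gt1/half_bound/andP[_ ?] _ _]; lra.
(* The Euler product up to [2 ^ (j + 5)] is still at least 1/2, and its part [Q] above [2 ^ j] is at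
   most [1 / (1 + T)]. *)
have P_ge : (1 + T) / 2 <= P.
  have := zeta_euler_product_ge (2 ^ (j + 5)) rho1 zeta_rho.
  rewrite (@primes_between_cat _ (2 ^ j)) ?leq_exp2l ?leq_addr // big_cat /= -/P.
  have := @sum_primes_powRN_ge R rho j (lt_trans ltr01 rho1) j2.
  rewrite -/x -/u -/A -/T.
  have := @prod_1B_le R nat (primes_between (2 ^ j) (2 ^ (j + 5))) (fun q => q%:R `^ (- rho)).
  set Q := \prod_(_ <- primes_between (2 ^ j) _) _; set S := \sum_(_ <- _) _ => h TS h2.
  have : Q * (1 + S) <= 1.
    apply: h => q; rewrite mem_primes_between.
    by move=> /and3P[/prime_gt1/half_bound/andP[? ?] _ _]; apply/andP; split; lra.
  have Q0 : 0 <= Q.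
    rewrite /Q big_seq prodr_ge0 // => q; rewrite mem_primes_between.
    by move=> /and3P[/prime_gt1/half_bound/andP[_ ?] _ _]; lra.
  move=> QS; have QT : Q * (1 + T) <= 1 by nra.
  have : P * (Q * (1 + T)) <= P by nra.
  nra.
have P1_ge : P * (1 - T / 4) <= P1.
  have F01 q : (1 < q)%N -> (0 : R) <= q%:R `^ (- rho) <= 1.
    by move=> /half_bound/andP[? ?]; apply/andP; split; lra.
  have split_le : P * (1 - \sum_(q <- primes n | (2 ^ j < q)%N) q%:R `^ (- rho)) <= P1.
    exact: (@prod_primes_split R n (2 ^ j) (fun q => q%:R `^ (- rho)) n0 F01).
  apply: le_trans split_le; rewrite ler_wpM2l // lerD2l lerN2.
  apply: (@le_trans _ _ (\sum_(q <- primes n | (2 ^ j < q)%N) (2 ^ j)%:R `^ (- rho))).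
    apply: ler_sum => q h; rewrite ler_powRN_nat ?expn_gt0 ?(ltnW h) //; lra.
  rewrite big_const_seq iter_addr_0 -[_ *+ count _ _]mulr_natl.
  apply: le_trans (ler_wpM2r (powR_ge0 _ _) few) _.
  by rewrite -(mulrA (A / 4)) xj /T mulrAC.
(* It remains to use [(1 + T) * (1 - T / 4) ^+ 2 >= 1], valid for [0 <= T <= 1]. *)
have : P * (1 - T / 4) * (1 - T / 4) <= P1 * P2 by apply: ler_pM => //; nra.
apply: le_trans; rewrite -mulrA; nra.
Qed.

(** * Integers with many large prime factors *)

(** Raising the exponent increases every factor, and the gain at the prime 2 alone is already linear
    in [d]. *)
Lemma prod_small_primes_ge (R : realType) (rho d : R) (j : nat) :
  1 < rho -> zeta rho = 2 -> 0 < d < 1 -> (0 < j)%N ->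
  (1 + 2 `^ (- rho) / 2 * d) / 2 <=
  \prod_(p <- primes_between 0 (2 ^ j)) (1 - p%:R `^ (- (rho + d))).
Proof.
move=> rho1 zeta_rho d01 j0; have /andP[d0 d1] := d01.
have := zeta_euler_product_ge (2 ^ j) rho1 zeta_rho.
have j1 : (2 <= 2 ^ j)%N by rewrite -{1}(expn1 2) leq_exp2l.
rewrite (@primes_between_cat _ 2) // (_ : primes_between 0 2 = [:: 2%N]) //=.
rewrite !big_cons.
set P := \prod_(_ <- _) _; set Q := \prod_(_ <- _) _; set a := 2 `^ (- rho).
have P0 : 0 <= P.
  rewrite /P big_seq prodr_ge0 // => q; rewrite mem_primes_between.
  by move=> /and3P[/prime_gt1 q1 _ _]; rewrite subr_ge0 ltW // powRN_nat_lt1 //; lra.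
have PQ : P <= Q.
  rewrite /P /Q big_seq [leRHS]big_seq; apply: ler_prod => q; rewrite mem_primes_between.
  move=> /and3P[/prime_gt1 q1 _ _]; rewrite subr_ge0 ltW ?powRN_nat_lt1 //=; last by lra.
  rewrite lerD2l lerN2 ler_powR ?ler1n ?(ltnW q1) //; lra.
have a0 : 0 < a by apply: (@powRN_nat_gt0 _ _ 2).
have a1 : a <= 1 / 2 by apply: (@powRN_nat_le_half _ _ 2) => //; exact: ltW.
have -> : 2 `^ (- (rho + d)) = a * 2 `^ (- d).
  by rewrite opprD powRD // pnatr_eq0 implybT.
(* Convexity between the exponents 0 and 1. *)
have e2 : 2 `^ (- d) <= 1 - d / 2.
  have := @powRN_convex R 0 1 d 2 isT d01.
  rewrite mulr0 add0r mulr1 oppr0 powRr0 mulr1 powR_inv1 //; lra.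
have : a * 2 `^ (- d) <= a * (1 - d / 2) by rewrite ler_wpM2l // ltW.
set b := a * 2 `^ (- d) => bd h.
have : (1 - a * (1 - d / 2)) * P <= (1 - b) * Q.
  by apply: ler_pM => //; nra.
apply: le_trans.
have : (1 - a) * (1 + a / 2 * d) <= 1 - a * (1 - d / 2) by nra.
have : 0 <= 1 + a / 2 * d by nra.
nra.
Qed.

Lemma m_le_many_large_primes (R : realType) (rho : R) : 1 < rho -> zeta rho = 2 ->
  exists C : R, 0 < C /\ forall n j : nat, (1 < n)%N -> (0 < j)%N ->
    C * ((2 `^ (1 - rho)) ^+ j / j%:R) < 1 ->
    (m n)%:R <= n%:R `^ (rho + C * ((2 `^ (1 - rho)) ^+ j / j%:R)) /
                2 ^+ count (fun q => 2 ^ j < q)%N (primes n).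
Proof.
move=> rho1 zeta_rho; have /andP[x0 x1] := powR2_lt1 rho1.
pose a : R := 2 `^ (- rho); have a0 : 0 < a by apply: (@powRN_nat_gt0 _ _ 2).
pose C4 : R := 2 / (1 - 2 `^ (1 - rho)).
have C40 : 0 < C4 by rewrite divr_gt0 ?subr_gt0.
(* This makes the gain [a / 2 * d] equal to [4 * C4 * u], twice the cost [2 * C4 * u] of the doubled
   primes; then [(1 + 4 * v) * (1 - 2 * v) >= 1] for [v = C4 * u <= 1 / 4]. *)
exists (8 * C4 / a); split; first by rewrite divr_gt0 // mulr_gt0.
move=> n j n1 j0 small; have n0 := ltnW n1.
have /andP[u0 _] := window_term_bounds rho1 j0.
set u := _ / j%:R in small u0 *; set d := _ * u in small *.
have d0 : 0 < d by rewrite mulr_gt0 // divr_gt0 // mulr_gt0.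
have d01 : 0 < d < 1 by rewrite d0.
have ad : a / 2 * d = 4 * C4 * u by rewrite /d; field; rewrite gt_eqF.
pose s : R := rho + d; have s1 : 1 <= s by rewrite /s; lra.
(* As a sum of valuations [w] is additive, so [2 ^+ w k] is completely multiplicative. *)
pose w k := (\sum_(p <- primes n | (2 ^ j < p)%N) logn p k)%N.
have w_prime q : q \in primes n -> w q = (2 ^ j < q)%N.
  rewrite mem_primes => /and3P[qp _ qn].
  rewrite /w (eq_bigr (fun p => if pred1 q p then 1%N else 0%N)); last first.
    by move=> p _; rewrite logn_prime.
  rewrite -big_filter -big_mkcond sum1_count count_uniq_mem ?filter_uniq ?primes_uniq //.
  by rewrite mem_filter mem_primes qp n0 qn !andbT.
pose F (q : nat) : R := (if (2 ^ j < q)%N then 2 else 1) * q%:R `^ (- s).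
have F01 q : (1 < q)%N -> 0 <= F q <= 1.
  move=> q1; have := powRN_nat_le_half s1 q1; have := powR_ge0 (q%:R : R) (- s).
  by rewrite /F; set z := _ `^ _; case: ifP => _ z0 z1; apply/andP; split; lra.
pose f (k : nat) : R := 2 ^+ w k * k%:R `^ (- s).
have f_prime q : q \in primes n -> f q = F q.
  by move=> qn; rewrite /f /F w_prime //; case: (_ < _)%N; rewrite ?expr1 ?expr0.
have fn : (m n)%:R * f n <= 1.
  apply: m_mul_le1 => //.
  - rewrite /f /w big1 ?mul1r ?powR1 // => p _; exact: logn1.
  - move=> k l k0 l0; rewrite /f powRN_natM mulrACA -exprD; congr (2 ^+ _ * _).
    by rewrite /w -big_split; apply: eq_bigr => p _; rewrite lognM.
  - by move=> k _; rewrite /f mulr_ge0 ?exprn_ge0 ?powR_ge0.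
  - move=> q qn; rewrite f_prime //; move: qn; rewrite mem_primes.
    by move=> /and3P[/prime_gt1/F01/andP[]].
  rewrite (@eq_big_seq _ _ _ _ _ _ (fun q => 1 - F q)); last first.
    by move=> q qn; rewrite f_prime.
  apply: le_trans (prod_primes_split (2 ^ j) n0 F01).
  have := prod_small_primes_ge rho1 zeta_rho d01 j0; rewrite -/a ad -/s.
  rewrite (@eq_big_seq _ _ _ _ (primes_between 0 (2 ^ j)) _ (fun q => 1 - F q)); last first.
    move=> q; rewrite mem_primes_between /F => /and3P[_ _].
    by rewrite leqNgt => /negbTE ->; rewrite mul1r.
  set P := \prod_(_ <- _) _; set S := \sum_(_ <- _ | _) _.
  have S_le : S <= 2 * (C4 * u).
    apply: (@le_trans _ _ (\sum_(q <- primes n | (2 ^ j < q)%N) 2 * q%:R `^ (- rho))).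
      rewrite /S big_seq_cond [leRHS]big_seq_cond; apply: ler_sum => q.
      rewrite mem_primes => /andP[/and3P[/prime_gt1 q1 _ _] qj].
      rewrite /F qj ler_wpM2l // ler_powR ?ler1n ?(ltnW q1) // /s; lra.
    rewrite -mulr_sumr ler_wpM2l //.
    (* The endpoint [2 ^ (j + n)] exceeds [n], hence all its primes. *)
    have jn : (0 < j <= j + n)%N by rewrite j0 leq_addr.
    apply: le_trans (sum_primes_powRN_le rho1 jn).
    rewrite -big_filter; apply: ler_sum_sub; first exact/filter_uniq/primes_uniq.
      move=> q; rewrite mem_filter mem_primes_between mem_primes.
      move=> /andP[-> /and3P[-> _ /(dvdn_leq n0) qn]] /=.
      apply: leq_trans qn (leq_trans (ltnW (ltn_expl n (ltnSn 1))) _).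
      by rewrite leq_exp2l // leq_addl.
    by move=> q _; exact: powR_ge0.
  have Cu : 0 < C4 * u by rewrite mulr_gt0.
  have Cu1 : 4 * (C4 * u) <= 1.
    have : a <= 1 / 2 by apply: (@powRN_nat_le_half _ _ 2) => //; exact: ltW.
    move: ad; nra.
  move=> hP; have : P * (1 - 2 * (C4 * u)) <= P * (1 - S).
    rewrite ler_wpM2l //; lra.
  apply: le_trans; nra.
have wn : (count (fun q => 2 ^ j < q)%N (primes n) <= w n)%N.
  rewrite -sum1_count /w big_seq_cond [leqRHS]big_seq_cond; apply: leq_sum => q.
  by rewrite -logn_gt0 => /andP[].
rewrite -/s ler_pdivlMr ?exprn_gt0 //.
have ns : 0 < n%:R `^ s by rewrite powR_gt0 // ltr0n.
move: fn; rewrite /f powRN mulrA ler_pdivrMr // mul1r; apply: le_trans.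
by rewrite ler_wpM2l // ler_weXn2l // ler1n.
Qed.

(** * Small integers *)

Section ExpBounds.
Variable R : realType.

Let S (n : nat) : R := series (@exp_coeff R 1) n.

(** These fractions are just sharp enough for [15 < e^e < 16], which reduces to [15^7 < (19/7)^19]
    and [(30/11)^30 < 16^11]. *)
Lemma expR1_bounds : (19 / 7 : R) < expR (1 : R) < 30 / 11.
Proof.
have SS n : S n.+1 = S n + n`!%:R^-1.
  by rewrite /S seriesSr /exp_coeff /= expr1n mul1r.
have S6 : S 6 = 163 / 60.
  rewrite !SS /S /series /= big_geq // !factS fact0 /= !muln1.
  by lra.
have cv : cvgn S by exact: is_cvg_series_exp_coeff.
have nd : nondecreasing_seq S.
  by apply/nondecreasing_seqP => n; rewrite SS lerDl invr_ge0.
(* S n + 2 / n! is nonincreasing *)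
have up n : (6 <= n)%N -> S n + 2 / n`!%:R <= 163 / 60 + 2 / 6`!%:R.
  elim: n => // n IH; rewrite leq_eqVlt => /orP[/eqP<-|]; first by rewrite S6.
  rewrite ltnS => n6; apply: le_trans (IH n6); rewrite SS -addrA lerD2l.
  rewrite factS natrM invfM; set a := (n`!%:R)^-1; set b := (n.+1%:R)^-1.
  have a0 : 0 <= a by rewrite invr_ge0.
  have b0 : b <= 1 / 2.
    by rewrite div1r lef_pV2 ?posrE ?ltr0n // ler_nat; lia.
  nra.
apply/andP; split.
  apply: (@lt_le_trans _ _ (S 6)); first by rewrite S6; lra.
  exact: nondecreasing_cvgn_le.
apply: (@le_lt_trans _ _ (163 / 60 + 2 / 6`!%:R)); last first.
  by rewrite !factS fact0 /= !muln1; lra.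
apply: limr_le => //; near=> n.
apply: le_trans (up n _); first by rewrite lerDl divr_ge0.
by near: n; exact: nbhs_infty_ge.
Unshelve. all: by end_near.
Qed.

Lemma expR_expR1_neq_nat (n : nat) : expR (expR 1) != n%:R :> R.
Proof.
have /andP[lo hi] := expR1_bounds.
have e0 : 0 <= expR 1 :> R by exact: expR_ge0.
have lo15 : 15 < expR (19 / 7) :> R.
  rewrite -(@ltr_pXn2r _ 7) ?nnegrE ?expR_ge0 // -expRM_natr mulfVK ?pnatr_eq0 //.
  rewrite -[19](mul1r 19) expRM_natr.
  apply: lt_trans (_ : (19 / 7) ^+ 19 < _); last first.
    by rewrite ltr_pXn2r // nnegrE; lra.
  lra.
have hi16 : expR (30 / 11) < 16 :> R.
  rewrite -(@ltr_pXn2r _ 11) ?nnegrE ?expR_ge0 // -expRM_natr mulfVK ?pnatr_eq0 //.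
  rewrite -[30](mul1r 30) expRM_natr.
  apply: lt_trans (_ : _ < (30 / 11) ^+ 30) _.
    by rewrite ltr_pXn2r // nnegrE; lra.
  lra.
apply/eqP => e.
have n15 : 15 < n%:R :> R by rewrite -e; apply: lt_trans lo15 _; rewrite ltr_expR.
have n16 : n%:R < 16 :> R by rewrite -e; apply: lt_trans hi16; rewrite ltr_expR.
by move: n15 n16; rewrite !ltr_nat; lia.
Qed.

End ExpBounds.

(** Strict because the divisors of [n] form a finite part of the zeta series. *)
Lemma m_lt_powR (R : realType) (rho : R) (n : nat) : 1 < rho -> zeta rho = 2 ->
  (1 < n)%N -> (m n)%:R < n%:R `^ rho :> R.
Proof.
move=> rho1 zeta_rho n1; have n0 := ltnW n1.
have sum_lt : \sum_(d <- divisors n | (1 < d)%N) d%:R `^ (- rho) < 1 :> R.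
  have := zeta_partial_lt rho1 n; rewrite zeta_rho.
  rewrite -[in iota _ _](prednK n0) /= big_cons powR1 => h.
  suff : \sum_(d <- divisors n | (1 < d)%N) d%:R `^ (- rho) <=
         \sum_(d <- iota 2 n.-1) d%:R `^ (- rho) :> R by lra.
  rewrite -big_filter; apply: ler_sum_sub.
  - exact/filter_uniq/divisors_uniq.
  - move=> d; rewrite mem_filter mem_iota -dvdn_divisors // => /andP[-> /(dvdn_leq n0)].
    by rewrite /=; lia.
  - by move=> d _; exact: powR_ge0.
have : (m n)%:R * n%:R `^ (- rho) < 1.
  apply: le_lt_trans (sum_lt).
  apply: (@m_mul_le_sum_divisors R (fun d => d%:R `^ (- rho))) => //.
  - by rewrite powR1.
  - by move=> a b _ _; rewrite powRN_natM.
  - by move: sum_lt => /ltW.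
by rewrite powRN ltr_pdivrMr ?mul1r // powR_gt0 // ltr0n.
Qed.

(** As [log log n] is positive and different from 1, its powers take every positive value, so the
    strict gap in [m_lt_powR] leaves room for some [t]. *)
Lemma m_lt_small (R : realType) (rho a : R) (n : nat) : 1 < rho -> zeta rho = 2 ->
  (2 < n)%N -> 0 <= a -> exists t : R,
  (m n)%:R < n%:R `^ rho / expR (a / ln (ln n%:R) `^ t).
Proof.
move=> rho1 zeta_rho n2 a0; have mn := m_lt_powR rho1 zeta_rho (ltnW n2).
have n0 : 0 < n%:R :> R by rewrite ltr0n; lia.
have ln1 : 1 < ln n%:R :> R.
  rewrite -ltr_expR lnK ?posrE //; have /andP[_ h] := expR1_bounds R.
  have : 3 <= n%:R :> R by rewrite ler_nat.
  lra.
set l := ln (ln n%:R); have l0 : 0 < l by exact: ln_gt0.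
have l1 : l != 1.
  apply: contra (expR_expR1_neq_nat R n) => /eqP e.
  have : expR (expR l) = n%:R by rewrite /l !lnK ?posrE //; lra.
  by rewrite e => ->.
have lnl : ln l != 0 by rewrite ln_eq0.
have [z z0 zP] : exists2 z : R, 0 < z & (m n)%:R * expR z < n%:R `^ rho.
  have [->|mpos] := posnP (m n).
    by exists 1 => //; rewrite mul0r powR_gt0.
  have m0 : 0 < (m n)%:R :> R by rewrite ltr0n.
  pose Q : R := n%:R `^ rho / (m n)%:R.
  have q1 : 1 < Q by rewrite ltr_pdivlMr // mul1r.
  have q0 := lt_trans ltr01 q1; have lnQ := ln_gt0 q1.
  exists (ln Q / 2); first by rewrite divr_gt0.
  have : expR (ln Q / 2) < expR (ln Q) by rewrite ltr_expR; lra.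
  by rewrite (lnK q0) ltr_pdivlMr // mulrC.
(* Solves [l]^ t = (a + 1) / z[, so that]a / l [^ t <= z]; the summand 1 keeps the logarithm
   meaningful when [a = 0]. *)
exists (ln ((a + 1) / z) / ln l).
have -> : l `^ (ln ((a + 1) / z) / ln l) = (a + 1) / z.
  rewrite /powR gt_eqF // divfK // lnK // posrE divr_gt0 //; lra.
rewrite ltr_pdivlMr ?expR_gt0 //; apply: le_lt_trans zP.
rewrite ler_wpM2l // ler_expR invf_div mulrCA -[leRHS]mulr1 ler_wpM2l ?(ltW z0) //.
by rewrite ler_pdivrMr ?mul1r; lra.
Qed.

(** * The bound for large integers *)

Lemma powR_addr_expR (R : realType) (n : nat) (a b : R) : (0 < n)%N ->
  n%:R `^ (a + b) = n%:R `^ a * expR (b * ln n%:R).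
Proof.
move=> n0; have n0' : n%:R != 0 :> R by rewrite pnatr_eq0 -lt0n.
by rewrite powRD ?n0' ?implybT // {2}/powR (negbTE n0').
Qed.

Lemma exists_dyadic_scale (R : realType) (z t : R) : 1 < z -> 1 < t ->
  exists2 j : nat, t <= z ^+ j & z ^+ j <= z * t.
Proof.
move=> z1 t1; have z0 : 0 < z := lt_trans ltr01 z1.
have lz : 0 < ln z := ln_gt0 z1.
have ex : exists j, t <= z ^+ j.
  have q0 : 0 <= ln t / ln z by rewrite divr_ge0 // ltW // ln_gt0.
  exists (Num.bound (ln t / ln z)).
  have := archi_boundP q0; set k := Num.bound _.
  rewrite ltr_pdivrMr // => h.
  rewrite -[leLHS]lnK ?posrE ?(lt_trans ltr01 t1) // -[leRHS]lnK ?posrE ?exprn_gt0 //.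
  by rewrite ler_expR lnXn // -mulr_natl ltW.
case: (ex_minnP ex) => j tj minj; exists j => //.
case: j => [|j] in tj minj *; first by move: tj; rewrite expr0; lra.
rewrite exprS ler_wpM2l ?(ltW z0) // leNgt; apply/negP => /ltW/minj.
by rewrite ltnn.
Qed.

Lemma m_le_exp (R : realType) (rho : R) : 1 < rho -> zeta rho = 2 ->
  exists c M : R, [/\ 0 < c, 1 < M & forall n : nat, (1 < n)%N -> M <= ln n%:R ->
    (m n)%:R <= n%:R `^ rho *
      expR (- (c * (ln n%:R `^ (1 / rho) / ln (ln n%:R))))].
Proof.
move=> rho1 zeta_rho.
have [c1 [kappa [c10 kappa0 few]]] := m_le_few_large_primes rho1 zeta_rho.
have [C [C0 many]] := m_le_many_large_primes rho1 zeta_rho.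
have ln2 : 0 < ln 2 :> R by apply: ln_gt0; rewrite ltr1n.
have rho0 : 0 < rho by lra.
pose z : R := 2 `^ rho.
have z1 : 1 < z.
  have := @powRN_nat_lt1 R rho 2 rho0 isT.
  by rewrite powRN invf_lt1 // powR_gt0.
have z0 : 0 < z by lra.
have lz : 0 < ln z by exact: ln_gt0.
have kl0 : 0 < kappa * ln 2 by rewrite mulr_gt0.
(* With [z ^+ j] at least [D * L], the loss [C * u * L] from the higher exponent is at most half of
   the gain [kappa * v * ln 2] from the large primes. *)
pose D : R := 1 + 2 * C / (kappa * ln 2).
have D1 : 1 <= D by rewrite lerDl divr_ge0 ?mulr_ge0 // ltW.
have D0 : 0 < D by lra.
have CD : C / D <= kappa * ln 2 / 2.
  have DK : D * (kappa * ln 2) = kappa * ln 2 + 2 * C.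
    by rewrite /D mulrDl mul1r divfK // gt_eqF.
  by rewrite ler_pdivrMr //; lra.
have zD0 : 0 < z * D by rewrite mulr_gt0.
pose c2 : R := Order.min (c1 / (z * D)) (kappa * ln 2 / 2).
have c20 : 0 < c2 by rewrite lt_min !divr_gt0.
pose j0 := Num.bound C.
(* The first summand forces [j >= j0 + 3], hence [j > 2] and [C * u < 1]; the second gives
   [ln (z * D) <= ln L]. *)
pose M : R := z ^+ (j0 + 3) + z * D.
have zj0 : 0 < z ^+ (j0 + 3) by rewrite exprn_gt0.
exists (c2 * (ln z / 2)), M; split; first by rewrite mulr_gt0 // divr_gt0.
  by rewrite /M; nra.
move=> n n1 nM; have n0 := ltnW n1.
set L := ln n%:R in nM *.
have L1 : 1 < L by rewrite /M in nM; nra.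
have L0 : 0 < L by lra.
have lL : 0 < ln L by exact: ln_gt0.
have DL : 1 < D * L by nra.
have [j jlo jhi] := exists_dyadic_scale z1 DL.
have jj0 : (j0 + 3 <= j)%N.
  rewrite -(ler_eXn2l z1); apply: le_trans jlo.
  rewrite /M in nM; nra.
have j2 : (2 < j)%N := leq_trans (leq_addl j0 3) jj0.
have jgt0 : (0 < j)%N := ltnW (ltnW j2).
have jp : 0 < j%:R :> R by rewrite ltr0n.
have Zj : (2 ^ j)%:R `^ rho = z ^+ j.
  by rewrite natrX -powR_mulrn // powRAC powR_mulrn // powR_ge0.
pose v : R := (2 ^ j)%:R / j%:R.
have v0 : 0 < v by rewrite divr_gt0 // ltr0n expn_gt0.
have zj : 0 < z ^+ j by rewrite exprn_gt0.
pose u : R := (2 `^ (1 - rho)) ^+ j / j%:R.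
have uE : u = v / z ^+ j.
  by rewrite /u /v -powRN_pow2 powRN Zj mulrAC.
have uL_hi : u * L <= v / D.
  rewrite uE mulrAC ler_pdivrMr // [leRHS]mulrAC ler_pdivlMr // -mulrA ler_wpM2l ?(ltW v0) //; lra.
have uL_lo : v / (z * D) <= u * L.
  rewrite uE [leRHS]mulrAC ler_pdivlMr // [leLHS]mulrAC ler_pdivrMr // -[leRHS]mulrA.
  rewrite ler_wpM2l ?(ltW v0) //; lra.
have Cu : C * u < 1.
  have u1 : u <= 1 / j%:R.
    rewrite /u ler_wpM2r ?invr_ge0 ?(ltW jp) //.
    have /andP[x0 x1] := powR2_lt1 rho1; by rewrite exprn_ile1 // ltW.
  apply: (@le_lt_trans _ _ (C * (1 / j%:R))); first by rewrite ler_wpM2l // ltW.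
  rewrite mulrA mulr1 ltr_pdivrMr // mul1r.
  apply: lt_le_trans (archi_boundP (ltW C0)) _; by rewrite ler_nat (leq_trans (leq_addr 3 j0) jj0).
have main : (m n)%:R <= n%:R `^ rho * expR (- (c2 * v)).
  have npos : 0 <= n%:R `^ rho by exact: powR_ge0.
  have [h|h] := leP (count (fun q => 2 ^ j < q)%N (primes n))%:R (kappa * v).
    apply: le_trans (few n j n1 j2 h) _; rewrite -/u powR_addr_expR // -/L.
    rewrite ler_wpM2l // ler_expR mulNr lerN2 -mulrA.
    apply: (@le_trans _ _ (c1 / (z * D) * v)).
      by rewrite ler_wpM2r ?(ltW v0) // ge_min lexx.
    by rewrite mulrAC -mulrA ler_wpM2l // ltW.
  apply: le_trans (many n j n1 jgt0 Cu) _; rewrite -/u powR_addr_expR // -/L.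
  set K := count _ _ in h *.
  have -> : 2 ^+ K = expR (K%:R * ln 2) :> R by rewrite expRM_natl lnK // posrE.
  rewrite -mulrA -expRN -expRD ler_wpM2l // ler_expR -[C * u * L]mulrA.
  have e1 : C * (u * L) <= kappa * ln 2 / 2 * v.
    apply: (@le_trans _ _ (C * (v / D))); first by rewrite ler_wpM2l // ltW.
    by rewrite mulrCA mulrC ler_wpM2r // ltW.
  have e2 : kappa * v * ln 2 <= K%:R * ln 2 by rewrite ler_wpM2r // ltW.
  have e3 : c2 * v <= kappa * ln 2 / 2 * v.
    by rewrite ler_wpM2r ?(ltW v0) // ge_min lexx orbT.
  lra.
apply: le_trans main _; rewrite ler_wpM2l ?powR_ge0 // ler_expR lerN2.
rewrite -mulrA ler_wpM2l ?(ltW c20) //.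
have L2j : L `^ (1 / rho) <= (2 ^ j)%:R.
  have -> : (2 ^ j)%:R = ((2 ^ j)%:R `^ rho) `^ (1 / rho) :> R.
    by rewrite -powRrM mul1r divff ?gt_eqF // powRr1.
  rewrite Zj ge0_ler_powR ?nnegrE ?divr_ge0 ?(ltW rho0) ?(ltW zj) ?(ltW L0) //.
  by apply: le_trans jlo; nra.
have jL : j%:R * ln z <= 2 * ln L.
  rewrite mulr_natl -lnXn //.
  apply: (@le_trans _ _ (ln (z * (D * L)))); first by rewrite ler_ln ?posrE ?mulr_gt0.
  rewrite mulrA lnM ?posrE //.
  have : ln (z * D) <= ln L by rewrite ler_ln ?posrE //; rewrite /M in nM; lra.
  lra.
have P0 : 0 <= L `^ (1 / rho) by exact: powR_ge0.
rewrite /v ler_pdivlMr //.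
set P := L `^ _ in L2j P0 *; set A := (2 ^ j)%:R in L2j *.
have -> : ln z / 2 * (P / ln L) * j%:R = P * (j%:R * ln z) / (2 * ln L).
  by field; rewrite gt_eqF.
rewrite ler_pdivrMr ?mulr_gt0 //; apply: ler_pM => //.
by rewrite mulr_ge0 // ltW.
Qed.

Theorem theorem7 (R : realType) (rho : R) (hrho : 1 < rho)
    (hzeta : zeta rho = 2) (eps : R) (heps : 0 < eps) :
  exists o : nat -> R,
    o @ \oo --> (0 : R) /\
    forall n : nat, (2 < n)%N ->
      (m n)%:R < n%:R `^ rho /
        expR (ln n%:R `^ (1 / rho) / ln (ln n%:R) `^ (1 + eps + o n)).
Proof.
have [c [M [c0 M1 bound]]] := m_le_exp hrho hzeta.
pose B : R := expR (ln (2 / c) / eps).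
pose M' : R := M + expR B.
have large n : (2 < n)%N -> M' <= ln n%:R ->
    (m n)%:R < n%:R `^ rho /
      expR (ln n%:R `^ (1 / rho) / ln (ln n%:R) `^ (1 + eps)).
  move=> n2 nM; have B0 : 0 < B by exact: expR_gt0.
  have eB : 1 < expR B by rewrite expR_gt1.
  have LM : M <= ln n%:R by rewrite /M' in nM; lra.
  have LB : expR B <= ln n%:R by rewrite /M' in nM; lra.
  have L0 : 0 < ln n%:R :> R by lra.
  apply: le_lt_trans (bound n (ltnW n2) LM) _.
  rewrite -expRN ltr_pM2l ?powR_gt0 ?ltr0n ?(ltnW (ltnW n2)) //.
  rewrite ltr_expR ltrN2.
  set L := ln n%:R in L0 LB *; set l := ln L.
  have lB : B <= l by rewrite -ler_expR lnK.
  have l0 : 0 < l by lra.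
  have le2 : 2 / c <= l `^ eps.
    have -> : 2 / c = B `^ eps.
      by rewrite /B -expRM divfK ?gt_eqF // lnK // posrE divr_gt0.
    by rewrite ge0_ler_powR ?nnegrE ?(ltW heps) ?(ltW B0) ?(ltW l0).
  have P0 : 0 < L `^ (1 / rho) by exact: powR_gt0.
  rewrite powRD; last by apply/implyP => _; rewrite gt_eqF.
  have cl : 1 < c * l `^ eps.
    by move: le2; rewrite ler_pdivrMr // mulrC; lra.
  have Y0 : 0 < l `^ eps by exact: powR_gt0.
  rewrite powRr1 ?(ltW l0) // ltr_pdivrMr ?mulr_gt0 //.
  have -> : c * (L `^ (1 / rho) / l) * (l * l `^ eps) = L `^ (1 / rho) * (c * l `^ eps).
    by field; rewrite gt_eqF.
  by rewrite ltr_pMr.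
have choose n : exists t : R, (2 < n)%N ->
    (m n)%:R < n%:R `^ rho /
      expR (ln n%:R `^ (1 / rho) / ln (ln n%:R) `^ (1 + eps + t)) /\
    (M' <= ln n%:R -> t = 0).
  have [n2|n2] := ltnP 2 n; last by exists 0.
  have [nM|nM] := leP M' (ln n%:R).
    by exists 0 => _; rewrite addr0; split => //; exact: large.
  have [t tP] := m_lt_small hrho hzeta n2 (powR_ge0 (ln n%:R) (1 / rho)).
  (* [m_lt_small] provides the whole exponent, from which [1 + eps] is subtracted. *)
  by exists (t - (1 + eps)) => _; rewrite subrKC; split => //; lra.
have [err errP] := boolp.choice choose.
exists err; split; last by move=> n n2; case: (errP n n2).
(* The error is exactly 0 as soon as [n >= expR M']. *)
apply: cvg_near_cst; near=> n.
have n2 : (2 < n)%N by near: n; exact: nbhs_infty_gt.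
case: (errP n n2) => _; apply; rewrite -ler_expR lnK ?posrE ?ltr0n; last by lia.
near: n; exact: nbhs_infty_ger.
Unshelve. all: by end_near.
Qed.
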